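(* Let $n\geq 1$ be an odd integer. Then there are infinitely many quintuples of imaginary quadratic fields $$\left(\mathbb{Q}(\sqrt{d}),\ \mathbb{Q}(\sqrt{d+1}),\ \mathbb{Q}(\sqrt{d+4}),\ \mathbb{Q}(\sqrt{d+36}),\ \mathbb{Q}(\sqrt{d+100})\right),$$ with $d\in\mathbb{Z}$, such that the class number of each of these five fields is divisible by $n$.
   Context: For a nonzero integer $m$ that is not a perfect square, $\mathbb{Q}(\sqrt{m})$ denotes the quadratic field obtained by adjoining a square root of $m$; it is imaginary quadratic when $m<0$. The class number of a number field is the order of its ideal class group. *)

(* Defs.v *)
From mathcomp Require Import all_boot all_order all_algebra all_field.
From mathcomp Require Import boolp classical_sets functions cardinality.
Set Implicit Arguments.
Unset Strict Implicit.
Unset Printing Implicit Defensive.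
Import Order.TTheory GRing.Theory Num.Theory.
Local Open Scope classical_set_scope.
Local Open Scope ring_scope.

(* Number fields are realised as subfields of [algC], so that equality of      *)
(* fields is equality of sets.                                                 *)

Definition is_subfield (K : set algC) : Prop := divring_closed (mem K).

Definition Qsqrt (m : int) : set algC :=
  smallest is_subfield [set sqrtC (m%:~R)].

Definition ring_of_integers (K : set algC) : set algC :=
  [set x | K x /\ x \in Aint].

Record fractional_ideal (K I : set algC) : Prop := FractionalIdeal {
  frac_sub : I `<=` K;
  frac_nonzero : exists2 x, I x & x != 0;
  frac_add : forall x y, I x -> I y -> I (x + y);
  frac_mul : forall a x, ring_of_integers K a -> I x -> I (a * x);
  frac_denominator : exists2 r, ring_of_integers K r /\ r != 0 &
    forall x, I x -> ring_of_integers K (r * x)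
}.

(* The coset of [I] modulo the nonzero principal fractional ideals: the        *)
(* product of the ideal generated by [a] with [I] is [a * I].                  *)
Definition ideal_class (K I : set algC) : set (set algC) :=
  [set J | exists2 a, K a /\ a != 0 & J = [set a * x | x in I]].

Definition class_group (K : set algC) : set (set (set algC)) :=
  [set ideal_class K I | I in fractional_ideal K].

(* A relation rather than a total function, so that no default value can stand *)
(* for the class number in case the class group were infinite.                 *)
Definition has_class_number (K : set algC) (h : nat) : Prop :=
  (class_group K #= `I_h)%card.

Definition class_number_divisible_by (n : nat) (K : set algC) : Prop :=
  exists2 h, has_class_number K h & (n %| h)%N.

(* Main.v *)
(* Let z be a large multiple of 60, y = 4 z^n - 1 and d = - y^n.  For x = 1, 2, 6, 10
   the element x + sqrt(d + x^2) has trace 2 x and norm y^n; for x = 0 the element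
   (1 + sqrt(-y)) / 2 has trace 1 and norm z^n.  So each field K contains an integer
   beta of norm N^n whose trace T is coprime to N and tiny compared with N, and the
   ideal (N, beta) has n-th power (beta).  Multiplication by it acts on the ideal
   classes by I |-> N I + beta I.  If its m-th power, for m | n and m < n, fixed a
   class, then beta = h^(n/m) for an integer h of K, the units stabilizing an ideal
   being 1 and -1; comparing traces modulo N^m and N^(2m) shows that this is
   impossible.  Hence all orbits have size n, and n divides the class number.
   Replacing n by its odd multiples makes the class numbers unbounded, which gives
   infinitely many fields. *)
Require Import Defs.
From mathcomp Require Import all_boot all_order all_algebra all_field.
From mathcomp Require Import boolp classical_sets functions cardinality.
From mathcomp Require Import zify ring lra.
Set Implicit Arguments.
Unset Strict Implicit.
Unset Printing Implicit Defensive.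
Import Order.TTheory GRing.Theory Num.Theory.
Local Open Scope classical_set_scope.
Local Open Scope ring_scope.

(** * Closure properties of subfields of [algC] *)

Lemma subfield1 K : is_subfield K -> K 1.
Proof. by case=> K1 _ _; move: K1; rewrite inE. Qed.

Lemma subfieldB K x y : is_subfield K -> K x -> K y -> K (x - y).
Proof. by case=> _ KB _ Kx Ky; apply: set_mem; apply: KB; apply: mem_set. Qed.

Lemma subfield_div K x y : is_subfield K -> K x -> K y -> K (x / y).
Proof. by case=> _ _ KD Kx Ky; apply: set_mem; apply: KD; apply: mem_set. Qed.

Lemma subfield0 K : is_subfield K -> K 0.
Proof. by move=> sK; rewrite -(subrr 1); apply: subfieldB => //; apply: subfield1. Qed.

Lemma subfieldN K x : is_subfield K -> K x -> K (- x).
Proof. by move=> sK Kx; rewrite -sub0r; apply: subfieldB => //; apply: subfield0. Qed.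

Lemma subfieldD K x y : is_subfield K -> K x -> K y -> K (x + y).
Proof.
by move=> sK Kx Ky; rewrite -[y]opprK; apply: subfieldB => //; apply: subfieldN.
Qed.

Lemma subfieldV K x : is_subfield K -> K x -> K x^-1.
Proof. by move=> sK Kx; rewrite -div1r; apply: subfield_div => //; apply: subfield1. Qed.

Lemma subfieldM K x y : is_subfield K -> K x -> K y -> K (x * y).
Proof.
by move=> sK Kx Ky; rewrite -[y]invrK; apply: subfield_div => //; apply: subfieldV.
Qed.

Lemma subfieldX K x k : is_subfield K -> K x -> K (x ^+ k).
Proof.
move=> sK Kx; elim: k => [|k IHk]; first by rewrite expr0; apply: subfield1.
by rewrite exprS; apply: subfieldM.
Qed.

Lemma subfield_int K (m : int) : is_subfield K -> K m%:~R.
Proof.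
move=> sK; have nat_in (k : nat) : K k%:R.
  elim: k => [|k IHk]; first exact: subfield0.
  by rewrite -natr1; apply: subfieldD => //; apply: subfield1.
case: m => k; first exact: nat_in.
by rewrite NegzE mulrNz; apply: subfieldN => //; apply: nat_in.
Qed.

Lemma subfield_Crat K x : is_subfield K -> x \in Crat -> K x.
Proof.
move=> sK /CratP[a ->]; rewrite /ratr.
by apply: subfield_div => //; apply: subfield_int.
Qed.

(** * The field Q(sqrt(-M)): coordinates, conjugation, trace and norm *)

Section ImaginaryQuadraticField.

Variable M : nat.
Hypothesis M_gt0 : (0 < M)%N.
Local Notation K := (Qsqrt (- M%:Z)).
Local Notation w := (sqrtC ((- M%:Z)%:~R : algC)).

Lemma sqr_w : w * w = - M%:R.
Proof. by rewrite -expr2 sqrtCK mulrNz. Qed.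

(** The conjugate of [w] has the same square [- M], so it is [w] or [- w]. If it were [w], then
    [w * w] would be a squared absolute value, hence nonnegative. *)
Lemma conj_w : w^* = - w.
Proof.
have : (w^* - w) * (w^* + w) = 0.
  by rewrite -subr_sqr -rmorphXn /= !expr2 sqr_w rmorphN rmorph_nat subrr.
move/eqP; rewrite mulf_eq0 => /orP[|]; last by rewrite addr_eq0 => /eqP.
rewrite subr_eq0 => /eqP wR.
have : 0 <= w * w by rewrite -{2}wR mul_conjC_ge0.
by rewrite sqr_w oppr_ge0 lern0 -leqn0 leqNgt M_gt0.
Qed.

Lemma Qsqrt_subfield m : is_subfield (Qsqrt m).
Proof.
split.
- by apply/mem_set => A /= [sA _]; apply: subfield1.
- move=> x y /set_mem Kx /set_mem Ky; apply/mem_set => A [/= sA wA].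
  by apply: subfieldB => //; [apply: Kx | apply: Ky].
- move=> x y /set_mem Kx /set_mem Ky; apply/mem_set => A [/= sA wA].
  by apply: subfield_div => //; [apply: Kx | apply: Ky].
Qed.

Lemma Qsqrt_w : K w.
Proof. by apply: sub_gen_smallest. Qed.

Lemma conj_Qsqrt a b : a \in Crat -> b \in Crat -> (a + b * w)^* = a - b * w.
Proof. by move=> Qa Qb; rewrite rmorphD rmorphM /= conj_w !conj_Crat // mulrN. Qed.

(** The combinations [a + b * w] with rational coefficients already form a subfield containing [w],
    so minimality of [Qsqrt] gives the forward direction. *)
Lemma QsqrtP x :
  K x <-> exists a b, [/\ a \in Crat, b \in Crat & x = a + b * w].
Proof.
split=> [Kx|[a [b [Qa Qb ->]]]]; last first.
  have sK := Qsqrt_subfield (- M%:Z).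
  apply: (subfieldD sK); first exact: subfield_Crat.
  by apply: (subfieldM sK); [exact: subfield_Crat | exact: Qsqrt_w].
pose S : set algC := [set x | exists a b, [/\ a \in Crat, b \in Crat & x = a + b * w]].
suff: S x by [].
refine (Kx S _); split; last first.
  by move=> _ ->; exists 0, 1; rewrite Crat0 Crat1 add0r mul1r.
split.
- by apply/mem_set; exists 1, 0; rewrite Crat0 Crat1 mul0r addr0.
- move=> _ _ /set_mem[a [b [Qa Qb ->]]] /set_mem[c [e [Qc Qe ->]]]; apply/mem_set.
  exists (a - c), (b - e); rewrite !rpredB //; split=> //; ring.
- move=> _ _ /set_mem[a [b [Qa Qb ->]]] /set_mem[c [e [Qc Qe ->]]]; apply/mem_set.
  pose N := c * c + M%:R * (e * e).
  have QN : N \in Crat by rewrite rpredD ?rpredM // rpred_nat.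
  exists ((a * c + M%:R * (b * e)) / N), ((b * c - a * e) / N).
  split; first by rewrite rpred_div // rpredD ?rpredM ?rpred_nat.
    by rewrite rpred_div // rpredB ?rpredM.
  have NE : N = (c + e * w) * (c - e * w).
    rewrite /N; have := sqr_w; move: w => v vv; ring: vv.
  (* Division by zero is [0] in [algC], so when the divisor vanishes the quotient to represent is
     [0]; [N] vanishes too and both coefficients become [0]. *)
  have [z0|nz] := eqVneq (c + e * w) 0.
    by rewrite NE z0 mul0r invr0 !mulr0 mul0r addr0.
  have cE : (c + e * w)^* = c - e * w by exact: conj_Qsqrt.
  have nz' : c - e * w != 0 by rewrite -cE conjC_eq0.
  have Nnz : N != 0 by rewrite NE mulf_neq0.
  apply: (mulIf nz); rewrite divfK //; apply: (mulIf Nnz).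
  have -> : (a * c + M%:R * (b * e)) / N + (b * c - a * e) / N * w =
            (a * c + M%:R * (b * e) + (b * c - a * e) * w) / N by ring.
  rewrite [RHS]mulrAC divfK //.
  rewrite NE; have := sqr_w; move: w => v vv; ring: vv.
Qed.

Lemma Qsqrt_conj x : K x -> K x^*.
Proof.
move=> /QsqrtP[a [b [Qa Qb ->]]]; apply/QsqrtP; exists a, (- b).
by rewrite rpredN Qa Qb conj_Qsqrt // mulNr.
Qed.

Lemma Qsqrt_trace x : K x -> x + x^* \in Crat.
Proof.
move=> /QsqrtP[a [b [Qa Qb ->]]].
rewrite conj_Qsqrt //.
by rewrite addrACA subrr addr0 rpredD.
Qed.

Lemma Qsqrt_norm x : K x -> x * x^* \in Crat.
Proof.
move=> /QsqrtP[a [b [Qa Qb ->]]].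
rewrite conj_Qsqrt //.
have -> : (a + b * w) * (a - b * w) = a * a + M%:R * (b * b).
  have := sqr_w; move: w => v vv; ring: vv.
by rewrite rpredD ?rpredM // rpred_nat.
Qed.

End ImaginaryQuadraticField.

(** Abstracts an imaginary quadratic field for the ideal arithmetic below: complex conjugation plays
    the role of the Galois conjugation, with rational traces and norms. *)
Definition rational_norm_form (K : set algC) : Prop :=
  [/\ is_subfield K, forall x, K x -> K x^*,
      forall x, K x -> x + x^* \in Crat & forall x, K x -> x * x^* \in Crat].

Lemma Qsqrt_rational_norm_form M :
  (0 < M)%N -> rational_norm_form (Qsqrt (- M%:Z)).
Proof.
move=> M0; split; first exact: Qsqrt_subfield.
- exact: Qsqrt_conj.
- exact: Qsqrt_trace.
- exact: Qsqrt_norm.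
Qed.

(** * Fractional ideals: shortest vectors and stabilizers *)

Definition scale_set (a : algC) (I : set algC) : set algC := [set a * x | x in I].

Lemma scale_set1 I : scale_set 1 I = I.
Proof.
apply/seteqP; split=> [_ [x Ix <-]|x Ix]; first by rewrite mul1r.
by exists x => //; rewrite mul1r.
Qed.

Lemma scale_setM a b I : scale_set a (scale_set b I) = scale_set (a * b) I.
Proof.
apply/seteqP; split=> [_ [_ [x Ix <-] <-]|_ [x Ix <-]].
  by exists x => //; rewrite mulrA.
by exists (b * x); [exists x | rewrite mulrA].
Qed.

Section Ideals.

Variable K : set algC.
Hypothesis K_norm_form : rational_norm_form K.
Local Notation OK := (ring_of_integers K).

Let sK : is_subfield K. Proof. by case: K_norm_form. Qed.

Lemma integers_int (m : int) : OK m%:~R.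
Proof. by split; [exact: subfield_int | exact: Aint_int]. Qed.

Lemma integersD x y : OK x -> OK y -> OK (x + y).
Proof. by move=> [Kx Ax] [Ky Ay]; split; [exact: subfieldD | rewrite rpredD]. Qed.

Lemma integersM x y : OK x -> OK y -> OK (x * y).
Proof. by move=> [Kx Ax] [Ky Ay]; split; [exact: subfieldM | rewrite rpredM]. Qed.

Lemma integers_conj x : OK x -> OK x^*.
Proof.
case: K_norm_form => _ Kc _ _ [Kx Ax]; split; first exact: Kc.
by rewrite Aint_aut.
Qed.

Lemma integers_trace x : OK x -> x + x^* \is a Num.int.
Proof.
move=> Ox; have [_ Ac] := integers_conj Ox; case: Ox => Kx Ax.
by case: K_norm_form => _ _ Ktr _; rewrite Cint_rat_Aint ?Ktr ?rpredD.
Qed.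

Lemma integers_norm x : OK x -> x * x^* \is a Num.nat.
Proof.
move=> Ox; have [_ Ac] := integers_conj Ox; case: Ox => Kx Ax.
case: K_norm_form => _ _ _ Knm; rewrite natrEint mul_conjC_ge0 andbT.
by rewrite Cint_rat_Aint ?Knm ?rpredM.
Qed.


Lemma ideal_opp I x : fractional_ideal K I -> I x -> I (- x).
Proof.
move=> fI Ix; rewrite -mulN1r; apply: (frac_mul fI) => //.
exact: (integers_int (-1)).
Qed.

Lemma ideal_sub I x y : fractional_ideal K I -> I x -> I y -> I (x - y).
Proof. by move=> fI Ix Iy; apply: (frac_add fI) => //; apply: ideal_opp. Qed.

(** After multiplication by a denominator [r], the elements of [I] have natural numbers as norms,
    and a set of natural numbers has a least element. *)
Lemma ideal_minimal_element I : fractional_ideal K I ->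
  exists c, [/\ I c, c != 0 & forall x, I x -> x != 0 -> `|c| <= `|x|].
Proof.
move=> fI; have [r [Or nzr] denI] := frac_denominator fI.
have [x0 Ix0 nzx0] := frac_nonzero fI.
pose P k := `[< exists x, [/\ I x, x != 0 & (r * x) * (r * x)^* = k%:R] >].
have inP x : I x -> x != 0 -> exists2 k, P k & (r * x) * (r * x)^* = k%:R.
  move=> Ix nzx; have /natrP[k kE] := integers_norm (denI x Ix).
  by exists k => //; apply/asboolP; exists x.
have exP : exists k, P k by have [k Pk _] := inP x0 Ix0 nzx0; exists k.
case: (ex_minnP exP) => k /asboolP[c [Ic nzc cE]] kmin.
exists c; split=> // x Ix nzx; have [j Pj jE] := inP x Ix nzx.
have : `|r * c| ^+ 2 <= `|r * x| ^+ 2.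
  by rewrite !normCK cE jE ler_nat; apply: kmin.
rewrite ler_pXn2r ?nnegrE // !normrM ler_pM2l // normr_gt0 //.
Qed.

(* A unit moves a shortest vector c of I to another one; since
   (u ^ 2 + 1) c = t u c lies in I, so does the distance from t to the nearest
   integer times u c, which is too short unless it is 0. *)
Lemma stabilizer_trace_int I u : fractional_ideal K I -> K u -> u != 0 ->
  scale_set u I = I -> u * u^* = 1 /\ u + u^* \is a Num.int.
Proof.
move=> fI Ku nzu uI; have [c [Ic nzc cmin]] := ideal_minimal_element fI.
have Iu x : I x -> I (u * x) by move=> Ix; rewrite -uI; exists x.
have c_gt0 : 0 < `|c| by rewrite normr_gt0.
have u1 : `|u| = 1.
  apply/eqP; rewrite eq_le; apply/andP; split.
    have : scale_set u I c by rewrite uI.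
    case=> c' Ic' cE.
    have nzc' : c' != 0 by apply: contraNneq nzc => c'0; rewrite -cE c'0 mulr0.
    have := cmin _ Ic' nzc'; rewrite -cE normrM -{2}[`|c'|]mul1r.
    by rewrite ler_pM2r // normr_gt0.
  have := cmin _ (Iu _ Ic) (mulf_neq0 nzu nzc).
  by rewrite normrM -{1}[`|c|]mul1r ler_pM2r.
have uu : u * u^* = 1 by rewrite -normCK u1 expr1n.
split=> //; have Qt : u + u^* \in Crat by case: K_norm_form => _ _ + _; apply.
set t := u + u^* in Qt *; have Rt := Creal_Crat Qt.
have Rh : t + 2^-1 \is Num.real by rewrite realD // realV.
have /andP[] := real_floor_itv Rh; set k := Num.Def.floor _.
rewrite intrD => lek ltk; have Rtk : t - k%:~R \is Num.real.
  by rewrite realB // realz.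
have [->|nzt] := eqVneq t k%:~R; first exact: intr_int.
have le_half : `|t - k%:~R| <= 2^-1.
  rewrite real_ler_norml //; apply/andP; split.
    by rewrite lerBrDr addrC lerBlDr.
  rewrite -subr_ge0.
  have -> : 2^-1 - (t - k%:~R) = k%:~R + 1 - (t + 2^-1) by field.
  by rewrite subr_ge0 ltW.
have Iz : I ((t - k%:~R) * (u * c)).
  have -> : (t - k%:~R) * (u * c) = u * (u * c) + c - k%:~R * (u * c).
    by rewrite /t; ring: uu.
  apply: ideal_sub => //; first by apply: (frac_add fI) => //; exact: Iu (Iu _ Ic).
  by apply: (frac_mul fI); [exact: integers_int | exact: Iu].
have := cmin _ Iz; rewrite !mulf_neq0 ?subr_eq0 // => /(_ isT).
rewrite !normrM u1 mul1r -{1}[`|c|]mul1r ler_pM2r // => /le_trans/(_ le_half).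
by rewrite -subr_ge0 (_ : 2^-1 - 1 = - 2^-1) ?oppr_ge0 ?invr_le0 ?lern0 //; field.
Qed.

End Ideals.

(** * Elements of norm 1 with integral trace, and an integrality criterion *)

(** Descent at 3: the equation forces 3 to divide [a], then [b]. This excludes units of trace 1 and
    -1. *)
Lemma square_mul_neq3 (M a b : nat) : ~~ (3 %| M)%N -> (0 < b)%N ->
  coprime a b -> (4 * (a * a * M) = 3 * (b * b))%N -> False.
Proof.
move=> M3 b0 cab E.
have: (3 %| 4 * (a * a * M))%N by rewrite E dvdn_mulr.
rewrite !Euclid_dvdM //= (negbTE M3) orbF orbb => a3.
have: (3 * 3 %| 3 * (b * b))%N by rewrite -E dvdn_mull // dvdn_mulr // dvdn_mul.
rewrite dvdn_pmul2l // Euclid_dvdM // orbb => b3.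
have : (3 %| gcdn a b)%N by rewrite dvdn_gcd a3.
by rewrite (eqP cab).
Qed.

(** Coprimality forces [a = 1], so [M] would be a square, hence 0 or 1 modulo 4. This excludes units
    of trace 0. *)
Lemma square_mul_neq1 (M a b : nat) : (1 < M %% 4)%N -> (0 < b)%N ->
  coprime a b -> (a * a * M = b * b)%N -> False.
Proof.
move=> M4 b0 cab E.
have: (a %| b * b)%N by rewrite -E -mulnA dvdn_mulr.
rewrite Gauss_dvdr // => ab.
have a1 : a = 1%N by apply/eqP; rewrite -dvdn1 -(eqP cab) dvdn_gcd dvdnn.
move: E M4; rewrite a1 !mul1n => ->.
rewrite -modnMm; have : (b %% 4 < 4)%N by rewrite ltn_mod.
by case: (b %% 4)%N => [|[|[|[|]]]].
Qed.

Lemma rat_square_fraction (x : algC) : x \in Crat -> exists a b : nat,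
  [/\ (0 < b)%N, coprime a b & x * x * (b * b)%:R = (a * a)%:R].
Proof.
move=> /CratP[q ->]; exists `|numq q|%N, `|denq q|%N; split.
- by rewrite absz_gt0 denq_neq0.
- exact: coprime_num_den.
have sq (m : int) : (`|m| * `|m|)%:R = (m * m)%:~R :> algC.
  by rewrite pmulrn PoszM abszE -normrM ger0_norm // -expr2 sqr_ge0.
rewrite !sq -{1 2}(divq_num_den q) fmorph_div /= !ratr_int !intrM.
have nz : (denq q)%:~R != 0 :> algC by rewrite intr_eq0 denq_neq0.
by field.
Qed.

(** Absolute value 1 bounds the integral trace [t] by 2. Computing the square of [u - u^*] as
    [t * t - 4] and as [- 4 b ^ 2 M] gives an equation in integers that excludes [t] = 0, 1, -1; for
    [t] = 2 or -2, [u] is a double root. *)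
Lemma unit_of_Qsqrt M u : (1 < M %% 4)%N -> ~~ (3 %| M)%N ->
  Qsqrt (- M%:Z) u -> u * u^* = 1 -> u + u^* \is a Num.int -> u = 1 \/ u = -1.
Proof.
move=> M4 M3 Ku uu /intrP[t tE].
have M0 : (0 < M)%N by case: M M4 {M3 Ku}.
have u1 : `|u| = 1 by apply/eqP; rewrite -sqrp_eq1 // normCK uu.
have t2 : `|t| <= 2.
  rewrite -(ler_int algC) intr_norm -tE.
  by apply: le_trans (ler_normD _ _) _; rewrite norm_conjC u1.
have dE : (u - u^*) * (u - u^*) = (t * t - 4)%:~R.
  by rewrite intrB intrM -tE; ring: uu.
have /QsqrtP[//|a [b [Qa Qb uE]]] := Ku.
have dE2 : (u - u^*) * (u - u^*) = - (4%:R * (b * b * M%:R)).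
  rewrite uE conj_Qsqrt //.
  have := sqr_w M; move: (sqrtC _) => v vv; ring: vv.
have [p [q [q0 cpq bE]]] := rat_square_fraction Qb.
have key : 4%:Z * (p * p * M)%:Z = (4 - t * t) * (q * q)%:Z.
  apply/eqP; rewrite -(eqr_int algC) !intrM -[(p * p * M)%:Z%:~R]/((p * p * M)%:R : algC).
  rewrite natrM -bE -[(q * q)%:Z%:~R]/((q * q)%:R : algC).
  have -> : (4 - t * t)%:~R = 4%:R * (b * b * M%:R) :> algC.
    by rewrite -[RHS]opprK -dE2 dE -intrN opprB.
  by apply/eqP; rewrite -[4%:~R]/(4%:R : algC); ring.
have : t = 0%Z \/ t = 1 \/ t = -1 \/ t = 2 \/ t = -2 by lia.
have pm s : t = 2 * s -> s * s = 1 -> u = s%:~R.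
  move=> ts s1; have : (u - s%:~R) * (u - s%:~R) = 0.
    have -> : (u - s%:~R) * (u - s%:~R) = u * u - u * (2 * s)%:~R + u * u^*.
      by have := congr1 (intmul (1 : algC)) s1; rewrite !intrM => s1'; ring: uu s1'.
    by rewrite -ts -tE; ring.
  by move/eqP; rewrite mulf_eq0 orbb subr_eq0 => /eqP.
case=> [t0|[t1|[t1|[t2'|t2']]]].
- exfalso; apply: (square_mul_neq1 M4 q0 cpq).
  by move: key; rewrite t0; move: (p * p * M)%N (q * q)%N; lia.
- exfalso; apply: (square_mul_neq3 M3 q0 cpq).
  by move: key; rewrite t1; move: (p * p * M)%N (q * q)%N; lia.
- exfalso; apply: (square_mul_neq3 M3 q0 cpq).
  by move: key; rewrite t1; move: (p * p * M)%N (q * q)%N; lia.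
- by left; apply: (pm 1).
- by right; rewrite (pm (-1)).
Qed.

(** Stated for [x ^+ r] being the quadratic root so as to cover both [beta], with [r = 1], and an
    [r]-th root of [beta]. *)
Lemma quadratic_root_Aint (a b : int) r (x : algC) : (0 < r)%N ->
  x ^+ (r + r) - a%:~R * x ^+ r + b%:~R = 0 -> x \in Aint.
Proof.
move=> r0 xE.
pose q : {poly algC} := b%:~R%:P - a%:~R%:P * 'X^r.
have sq : (size q <= r.+1)%N.
  rewrite (leq_trans (size_polyD _ _)) // geq_max size_polyN.
  rewrite (leq_trans (size_polyC_leq1 _)) // (leq_trans (size_polyMleq _ _)) //.
  by rewrite size_polyXn addnS /= -add1n leq_add2r size_polyC_leq1.
have sqX : (size q < size ('X^(r + r) : {poly algC}))%N.
  by rewrite size_polyXn ltnS; lia.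
apply: (@root_monic_Aint ('X^(r + r) + q)).
- apply/rootP; by rewrite /q !hornerE /= -[RHS]xE addrAC.
- by rewrite monicE lead_coefDl // lead_coefXn.
- apply/polyOverP=> i; rewrite /q !coefE -mulrb.
  rewrite rpredD ?rpredB ?rpredM ?rpred_nat ?intr_int //.
  by rewrite rpredMn //; exact: intr_int.
Qed.

(** * Multiplication by the ideal (N^j, beta) and its iterates *)

(** The product of [I] with the ideal generated by [N ^ j] and [beta], written out on the two
    generators. *)
Definition Phi (N : nat) (beta : algC) (j : nat) (I : set algC) : set algC :=
  [set z | exists x y, [/\ I x, I y & z = (N ^ j)%:R * x + beta * y]].

Lemma Phi_scale N beta j a I :
  Phi N beta j (scale_set a I) = scale_set a (Phi N beta j I).
Proof.
apply/seteqP; split=> [_ [_ [_ [[x Ix <-] [y Iy <-] ->]]]|_ [_ [x [y [Ix Iy ->]]] <-]].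
  by exists ((N ^ j)%:R * x + beta * y); [exists x, y | ring].
by exists (a * x), (a * y); split; [exists x | exists y | ring].
Qed.

Section PhiIterates.

Variable K : set algC.
Hypothesis K_norm_form : rational_norm_form K.
Local Notation OK := (ring_of_integers K).

Variables (N n T : nat) (beta : algC).
Hypothesis Obeta : OK beta.
Hypothesis trace_beta : beta + beta^* = T%:R.
Hypothesis norm_beta : beta * beta^* = (N ^ n)%:R.
Hypothesis coprime_TN : coprime T N.
Hypothesis N_gt0 : (0 < N)%N.

Local Notation Phi := (Phi N beta).

Let Onat (k : nat) : OK k%:R.
Proof. exact: (integers_int K_norm_form k). Qed.

Lemma Phi_fractional j I : fractional_ideal K I -> fractional_ideal K (Phi j I).
Proof.
move=> fI; have [sI [x0 Ix0 nz0] addI mulI [r [Or nzr] denI]] := fI.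
have I0 : I 0 by rewrite -(subrr x0); apply: (ideal_sub K_norm_form).
have PhiI x : Phi j I x -> I x.
  move=> [y [z [Iy Iz ->]]]; apply: addI; first exact: mulI (Onat _) Iy.
  exact: mulI Obeta Iz.
split.
- by move=> x /PhiI/sI.
- exists ((N ^ j)%:R * x0).
    by exists x0, 0; rewrite mulr0 addr0.
  by rewrite mulf_neq0 // pnatr_eq0 -lt0n expn_gt0 N_gt0.
- move=> _ _ [x [y [Ix Iy ->]]] [x' [y' [Ix' Iy' ->]]].
  by exists (x + x'), (y + y'); split; [exact: addI | exact: addI | ring].
- move=> a _ Oa [x [y [Ix Iy ->]]].
  by exists (a * x), (a * y); split; [exact: mulI | exact: mulI | ring].
- by exists r => // x /PhiI/denI.
Qed.

Lemma Phi0 I : fractional_ideal K I -> Phi 0 I = I.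
Proof.
move=> fI; have I0 x : I x -> I 0.
  by move=> Ix; rewrite -(subrr x); apply: (ideal_sub K_norm_form).
apply/seteqP; split=> [_ [x [y [Ix Iy ->]]]|x Ix].
  rewrite expn0 mul1r; apply: (frac_add fI) => //.
  exact: (frac_mul fI Obeta).
by exists x, 0; rewrite mulr0 addr0 expn0 mul1r; split=> //; apply: I0 Ix.
Qed.

(* beta I lies in Phi 1 (Phi j I) because N beta and
   T beta = beta ^ 2 + N ^ n both do, and T and N are coprime. *)
Lemma PhiS j I : fractional_ideal K I -> (j < n)%N -> Phi 1 (Phi j I) = Phi j.+1 I.
Proof.
move=> fI ltjn; have [sI _ addI mulI _] := fI.
have beta2 : beta * beta = T%:R * beta - (N ^ n)%:R.
  by rewrite -trace_beta -norm_beta; ring.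
apply/seteqP; split.
  move=> _ [_ [_ [[x [y [Ix Iy ->]]] [x' [y' [Ix' Iy' ->]]] ->]]].
  exists x, (N%:R * y + (N ^ j)%:R * x' + beta * y'); split=> //.
    by apply: (addI); [apply: (addI); apply: (mulI) | apply: (mulI)].
  by rewrite expn1 expnS natrM; ring.
have fPP := Phi_fractional 1 (Phi_fractional j fI).
move=> _ [x [y [Ix Iy ->]]].
have I0 : I 0 by rewrite -(subrr x); apply: (ideal_sub K_norm_form).
apply: (frac_add fPP).
  exists ((N ^ j)%:R * x), 0; split; last by rewrite expn1 expnS natrM; ring.
    by exists x, 0; split=> //; ring.
  by exists 0, 0; split=> //; ring.
have PN : Phi 1 (Phi j I) (N%:R * (beta * y)).
  exists (beta * y), 0; split; last by rewrite expn1; ring.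
    by exists 0, y; split=> //; ring.
  by exists 0, 0; split=> //; ring.
have PT : Phi 1 (Phi j I) (T%:R * (beta * y)).
  have -> : T%:R * (beta * y) =
      (N ^ 1)%:R * ((N ^ j)%:R * ((N ^ (n - j.+1))%:R * y) + beta * 0) +
      beta * ((N ^ j)%:R * 0 + beta * y).
    have Nn : (N ^ n)%:R = N%:R * (N ^ j)%:R * (N ^ (n - j.+1))%:R :> algC.
      by rewrite -!natrM -expnS -expnD subnKC.
    by rewrite Nn in beta2; rewrite expn1; ring: beta2.
  exists ((N ^ j)%:R * ((N ^ (n - j.+1))%:R * y) + beta * 0),
    ((N ^ j)%:R * 0 + beta * y); split=> //.
    by exists ((N ^ (n - j.+1))%:R * y), 0; split=> //; apply: mulI.
  by exists 0, y.
have [u [v uv]] := Bezoutz T N.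
have -> : beta * y = u%:~R * (T%:R * (beta * y)) + v%:~R * (N%:R * (beta * y)).
  have uv1 : u%:~R * T%:R + v%:~R * N%:R = 1 :> algC.
    have := congr1 (intmul (1 : algC)) uv; rewrite intrD !intrM.
    by rewrite /gcdz /= (eqP coprime_TN).
  by rewrite !mulrA -mulrDl -mulrDl uv1 mul1r.
by apply: (frac_add fPP); apply: (frac_mul fPP) => //; apply: integers_int.
Qed.

Lemma iter_Phi j I : fractional_ideal K I -> (j <= n)%N -> iter j (Phi 1) I = Phi j I.
Proof.
move=> fI; elim: j => [|j IHj] ltjn; first by rewrite Phi0.
by rewrite iterS IHj ?PhiS // ltnW.
Qed.

(** Since [N ^ n] is [beta] times its conjugate, the generator [N ^ n] is redundant. *)
Lemma Phi_n I : fractional_ideal K I -> Phi n I = scale_set beta I.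
Proof.
move=> fI; apply/seteqP; split=> [_ [x [y [Ix Iy ->]]]|_ [y Iy <-]].
  exists (beta^* * x + y); last by rewrite -norm_beta; ring.
  apply: (frac_add fI) => //; apply: (frac_mul fI) => //.
  exact: (integers_conj K_norm_form Obeta).
exists 0, y; split=> //; last by rewrite mulr0 add0r.
by rewrite -(subrr y); apply: (ideal_sub K_norm_form).
Qed.

(** Applying [Phi m] to [I] repeatedly, [r] times, multiplies it by [g ^+ r], because [Phi] commutes
    with scaling; the same [n] elementary steps amount to [Phi n], which is scaling by [beta]. *)
Lemma iter_Phi_fixed m r g I : fractional_ideal K I -> (r * m)%N = n ->
  (0 < r)%N -> Phi m I = scale_set g I -> scale_set (g ^+ r) I = scale_set beta I.
Proof.
move=> fI rmn r0 PhiI.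
have le_mn : (m <= n)%N by rewrite -rmn leq_pmull.
have key k : iter (k * m) (Phi 1) I = scale_set (g ^+ k) I.
  elim: k => [|k IHk]; first by rewrite mul0n expr0 scale_set1.
  rewrite mulSn iterD IHk.
  have scale_iter a j : iter j (Phi 1) (scale_set a I) = scale_set a (iter j (Phi 1) I).
    by elim: j => //= j ->; rewrite Phi_scale.
  by rewrite scale_iter iter_Phi // PhiI scale_setM -exprSr.
by rewrite -key rmn iter_Phi // Phi_n.
Qed.

End PhiIterates.

(** * Power sums of a conjugate pair and the size contradiction *)

Lemma power_sum_rec (R : comPzRingType) (g h : R) k :
  g ^+ k.+2 + h ^+ k.+2 =
  (g + h) * (g ^+ k.+1 + h ^+ k.+1) - g * h * (g ^+ k + h ^+ k).
Proof. rewrite !exprS; ring. Qed.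

(** The first two terms of the expansion of a power sum in terms of the sum [t] and the product
    [Y]. *)
Lemma power_sum_mod_sqr (g h : algC) (t Y : int) : g + h = t%:~R -> g * h = Y%:~R ->
  forall j, exists q : int, g ^+ j.+2 + h ^+ j.+2 =
    (t ^+ j.+2 - j.+2%:Z * t ^+ j * Y + Y ^+ 2 * q)%:~R.
Proof.
move=> tE YE j.
(* The recurrence has order two, so two consecutive exponents are carried through the induction. *)
suff [//] : (exists q : int, g ^+ j.+2 + h ^+ j.+2 =
    (t ^+ j.+2 - j.+2%:Z * t ^+ j * Y + Y ^+ 2 * q)%:~R) /\
  (exists q : int, g ^+ j.+3 + h ^+ j.+3 =
    (t ^+ j.+3 - j.+3%:Z * t ^+ j.+1 * Y + Y ^+ 2 * q)%:~R).
elim: j => [|j [[q qE] [q' qE']]].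
  have s2 : g ^+ 2 + h ^+ 2 = (t * t - 2 * Y)%:~R.
    by rewrite intrB !intrM -tE -YE; ring.
  split; exists 0; first by rewrite s2; congr (_%:~R); ring.
  by rewrite power_sum_rec s2 !expr1 tE YE -!intrM -intrB; congr (_%:~R); ring.
split; first by exists q'.
exists (t * q' + j.+2%:Z * t ^+ j - Y * q).
rewrite power_sum_rec qE qE' tE YE -!intrM -intrB; congr (_%:~R).
have -> : j.+4%:Z = j.+2%:Z + 2 by lia.
have -> : j.+3%:Z = j.+2%:Z + 1 by lia.
by rewrite !exprS; ring.
Qed.

(** In the recurrence the first term carries the factor [t] and the second inherits it from the
    exponent two below, so divisibility by [t] propagates along odd exponents. *)
Lemma power_sum_odd_dvd (g h : algC) (t Y : int) : g + h = t%:~R -> g * h = Y%:~R ->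
  forall j, exists q : int, g ^+ j.*2.+1 + h ^+ j.*2.+1 = (t * q)%:~R.
Proof.
move=> tE YE; elim=> [|j [q qE]]; first by exists 1; rewrite !expr1 tE mulr1.
have [q' q'E] : exists q' : int, g ^+ j.*2.+2 + h ^+ j.*2.+2 = q'%:~R.
  by have [a ->] := power_sum_mod_sqr tE YE j.*2; eexists.
exists (q' - Y * q); rewrite doubleS power_sum_rec qE q'E tE YE.
by rewrite -!intrM -intrB; congr (_%:~R); ring.
Qed.

(** As [t] divides [T], all quantities in [t] are small against [Y]. Modulo [Y] this gives
    [T = t ^+ j.+2]; modulo [Y ^+ 2] the next term then yields [j.+2 * t ^+ j = Y * q], again too
    small unless 0, while [t] is nonzero. *)
Lemma power_trace_bound (t Y q q' : int) (T j n : nat) : (0 < T)%N ->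
  T%:Z = t ^+ j.+2 - j.+2%:Z * t ^+ j * Y + Y ^+ 2 * q -> T%:Z = t * q' ->
  (j.+2 <= n)%N -> (T + n.+1 * T ^ n)%:Z < Y -> False.
Proof.
move=> T0 TE tT jn Ybig.
have nzt : t != 0 by apply: contra_eqN tT => /eqP ->; rewrite mul0r; lia.
have nzq' : q' != 0 by apply: contra_eqN tT => /eqP ->; rewrite mulr0; lia.
have tleT : (`|t| <= T)%N.
  have -> : T = (`|t| * `|q'|)%N by rewrite -abszM -tT.
  by rewrite leq_pmulr // absz_gt0.
have t0 : (0 < `|t|)%N by rewrite absz_gt0.
have pow_le k : (k <= n)%N -> (`|t ^+ k| <= T ^ n)%N.
  move=> kn; rewrite abszX; apply: leq_trans (leq_pexp2l T0 kn).
  by case: k {kn} => // k; rewrite leq_exp2r.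
have small a b : a = Y * b -> (`|a| <= T + n.+1 * T ^ n)%N -> a = 0 /\ b = 0.
  move=> ab ale; have [b0|nzb] := eqVneq b 0; first by rewrite ab b0 mulr0.
  have : (`|Y| <= `|a|)%N by rewrite ab abszM leq_pmulr // absz_gt0.
  by move=> Yle; exfalso; move: (n.+1 * T ^ n)%N Ybig ale Yle; lia.
have [_ E2] : T%:Z - t ^+ j.+2 = 0 /\ Y * q - j.+2%:Z * t ^+ j = 0.
  apply: small; first by rewrite TE; ring.
  have := pow_le _ jn; rewrite mulSn; move: (t ^+ j.+2) (T ^ n)%N (n * _)%N; lia.
have E3 : j.+2%:Z * t ^+ j = Y * q by apply/eqP; rewrite eq_sym -subr_eq0 E2.
have [] := small _ _ E3.
  rewrite abszM absz_nat (leq_trans (leq_mul (leqW jn) (pow_le j _))) ?leq_addl //.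
  by apply: leq_trans jn; rewrite leqW.
by move=> /eqP; rewrite mulf_eq0 expf_eq0 (negbTE nzt) andbF.
Qed.

(** * Proper powers of the ideal (N, beta) fix no ideal class *)

Section FixedClass.

Variables (M N n T : nat) (beta : algC).
Local Notation K := (Qsqrt (- M%:Z)).
Hypothesis M_mod4 : (1 < M %% 4)%N.
Hypothesis M_mod3 : ~~ (3 %| M)%N.
Hypothesis n_odd : odd n.
Hypothesis K_beta : K beta.
Hypothesis trace_beta : beta + beta^* = T%:R.
Hypothesis norm_beta : beta * beta^* = (N ^ n)%:R.
Hypothesis coprime_TN : coprime T N.
Hypothesis T_gt0 : (0 < T)%N.
Hypothesis N_big : (T + n.+1 * T ^ n < N)%N.

Lemma integers_beta : ring_of_integers K beta.
Proof.
split=> //; apply: (@quadratic_root_Aint T%:Z (N ^ n)%:Z 1) => //.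
have -> : T%:Z%:~R = beta + beta^* :> algC by rewrite trace_beta.
have -> : (N ^ n)%:Z%:~R = beta * beta^* :> algC by rewrite norm_beta.
by rewrite expr1 expr2; ring.
Qed.

Lemma Phi_not_scale m I g : fractional_ideal K I -> (m %| n)%N -> (0 < m < n)%N ->
  K g -> g != 0 -> Phi N beta m I = scale_set g I -> False.
Proof.
move=> fI /dvdnP[r nE] /andP[m0 mn] Kg nzg PhiI.
have M0 : (0 < M)%N by case: (M) M_mod4.
have nf := Qsqrt_rational_norm_form M0.
have sK : is_subfield K by case: nf.
have r1 : (1 < r)%N by move: mn; rewrite nE; case: (r) => [|[|]] //; lia.
have r_odd : odd r by move: n_odd; rewrite nE oddM => /andP[].
have N0 : (0 < N)%N by case: (N) N_big.
have grb := iter_Phi_fixed nf integers_beta trace_beta norm_beta coprime_TN N0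
  fI (esym nE) (ltnW r1) PhiI.
have nzb : beta != 0.
  have : beta * beta^* != 0 by rewrite norm_beta pnatr_eq0 -lt0n expn_gt0 N0.
  by rewrite mulf_eq0 negb_or => /andP[].
(* [g ^+ r] and [beta] scale [I] to the same ideal, so their quotient stabilizes [I]. *)
pose u := g ^+ r / beta.
have Ku : K u by apply: (subfield_div sK) => //; apply: (subfieldX _ sK).
have nzu : u != 0 by rewrite mulf_neq0 ?invr_eq0 // expf_neq0.
have uI : scale_set u I = I.
  by rewrite /u mulrC -scale_setM grb scale_setM mulVf // scale_set1.
have [uu ut] := stabilizer_trace_int nf fI Ku nzu uI.
have [h [Kh hr]] : exists h, K h /\ h ^+ r = beta.
  case: (unit_of_Qsqrt M_mod4 M_mod3 Ku uu ut) => uE.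
    by exists g; split=> //; rewrite -[LHS](divfK nzb) -/u uE mul1r.
  (* The sign is absorbed because [r] is odd. *)
  exists (- g); split; first exact: (subfieldN sK).
  rewrite exprNn -signr_odd r_odd expr1 mulN1r.
  by rewrite -[g ^+ r](divfK nzb) -/u uE mulN1r opprK.
have Oh : ring_of_integers K h.
  split=> //; apply: (@quadratic_root_Aint T%:Z (N ^ n)%:Z r); first exact: ltnW.
  have -> : T%:Z%:~R = beta + beta^* :> algC by rewrite trace_beta.
  have -> : (N ^ n)%:Z%:~R = beta * beta^* :> algC by rewrite norm_beta.
  by rewrite exprD hr; ring.
have /intrP[t tE] := integers_trace nf Oh.
have YE : h * h^* = (N ^ m)%:Z%:~R.
  (* Both sides are nonnegative with the same [r]-th power [N ^ n]. *)
  apply/eqP; rewrite -(@eqrXn2 _ r) ?(ltnW r1) ?mul_conjC_ge0 ?ler0n //.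
  rewrite exprMn -rmorphXn /= hr norm_beta -[(N ^ m)%:Z%:~R]/((N ^ m)%:R : algC).
  by rewrite -natrX -expnM mulnC nE.
have sT : h ^+ r + h^* ^+ r = T%:Z%:~R by rewrite -rmorphXn /= hr trace_beta.
have [j rE] : exists j, r = j.+2 by exists r.-2; lia.
have [q qE] := power_sum_mod_sqr tE YE j.
have [q' qE'] := power_sum_odd_dvd tE YE r./2.
have r2 : (r./2).*2.+1 = r by rewrite -[RHS]odd_double_half r_odd.
apply: (@power_trace_bound t (N ^ m)%N q q' T j n) => //.
- by apply: (@intr_inj algC); rewrite -sT rE qE.
- by apply: (@intr_inj algC); rewrite -sT -qE' r2.
- by rewrite -rE nE leq_pmulr.
- by rewrite ltz_nat (leq_trans N_big) // -{1}(expn1 N) leq_pexp2l.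
Qed.

End FixedClass.

(** * From free orbits to divisibility of the class number *)

(** Every orbit length divides [n], so it is enough to test divisors of [n] to see that all orbits
    have exactly [n] elements. *)
Lemma dvdn_card_free_iter (T : finType) (f : T -> T) n : (0 < n)%N ->
  (forall x, iter n f x = x) ->
  (forall m x, (m %| n)%N -> (0 < m < n)%N -> iter m f x <> x) -> (n %| #|T|)%N.
Proof.
move=> n0 fn free.
have f_inj : injective f.
  have fE x : iter n.-1 f (f x) = x by rewrite -iterSr prednK.
  by apply: can_inj fE.
have iter_mul a x : iter a f x = x -> forall k, iter (k * a) f x = x.
  by move=> fa; elim=> // k IHk; rewrite mulSn iterD IHk.
have ordn x : order f x = n.
  have o0 := order_gt0 f x; have ox := iter_order f_inj x.
  have on : (order f x %| n)%N.
    have fmod : iter (n %% order f x) f x = x.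
      by have := fn x; rewrite {1}(divn_eq n (order f x)) addnC iterD (iter_mul _ _ ox).
    have lt_mod : (n %% order f x < order f x)%N by rewrite ltn_mod.
    have := findex_iter lt_mod; rewrite fmod findex0 => /esym mod0.
    by rewrite /dvdn mod0.
  have [//|neq] := eqVneq (order f x) n; exfalso; apply: (free _ x on) => //.
  by rewrite o0 ltn_neqAle neq dvdn_leq.
have sub : T \subset order_set f n by apply/fintype.subsetP => x _; rewrite inE ordn.
by rewrite -(fcard_order_set f_inj sub) // dvdn_mull.
Qed.

Lemma dvdn_card_free_iter_set (X : pointedType) (A : set X) (f : X -> X) n h :
  (A #= `I_h)%card -> (0 < n)%N -> (forall x, A x -> A (f x)) ->
  (forall x, A x -> iter n f x = x) ->
  (forall m x, A x -> (m %| n)%N -> (0 < m < n)%N -> iter m f x <> x) -> (n %| h)%N.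
Proof.
rewrite card_eq_sym => /card_set_bijP[e [eA e_inj e_surj]] n0 fA fn free.
have Ae (i : 'I_h) : A (e i) by apply: eA; exact: ltn_ord.
have exF (i : 'I_h) : exists k : 'I_h, e k = f (e i).
  by have [k /= kh <-] := e_surj _ (fA _ (Ae i)); exists (Ordinal kh).
pose F i := sval (cid (exF i)).
have FE i : e (F i) = f (e i) by rewrite /F; case: (cid _).
have iterF m i : e (iter m F i) = iter m f (e i) by elim: m => //= m <-; rewrite FE.
have e_inj' (i k : 'I_h) : e i = e k -> i = k.
  by move=> eik; apply/val_inj/e_inj => //; rewrite inE /=; exact: ltn_ord.
rewrite -(card_ord h); apply: (@dvdn_card_free_iter _ F) => //.
  by move=> i; apply: e_inj'; rewrite iterF fn.
move=> m i mn m0 /(congr1 (fun k : 'I_h => e k)); rewrite iterF; exact: free.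
Qed.

Lemma ideal_class_scale K I a : is_subfield K -> K a -> a != 0 ->
  ideal_class K (scale_set a I) = ideal_class K I.
Proof.
move=> sK Ka nza; apply/seteqP; split=> J [b [Kb nzb] JE].
  exists (b * a); first by split; [exact: subfieldM | rewrite mulf_neq0].
  by rewrite JE -/(scale_set _ _) -/(scale_set b _) scale_setM.
exists (b / a); first by split; [exact: subfield_div | rewrite mulf_neq0 ?invr_eq0].
by rewrite JE -/(scale_set b _) -/(scale_set (b / a) _) scale_setM divfK.
Qed.

Lemma ideal_class_eq K I J : is_subfield K -> ideal_class K I = ideal_class K J ->
  exists g, [/\ K g, g != 0 & I = scale_set g J].
Proof.
move=> sK IJ; have : ideal_class K I I.
  exists 1; first by split; [exact: subfield1 | rewrite oner_eq0].
  exact: (esym (scale_set1 I)).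
by rewrite IJ => -[g [Kg nzg] ->]; exists g.
Qed.

(** Acting on a class by taking images of all its members avoids choosing a representative;
    compatibility with scaling makes the result a single class. *)
Lemma image_Phi_class N beta K I :
  [set Phi N beta 1 J | J in ideal_class K I] = ideal_class K (Phi N beta 1 I).
Proof.
apply/seteqP; split=> [_ [_ [a Ka ->] <-]|_ [a Ka ->]].
  by exists a => //; rewrite -[RHS]/(scale_set a _) -Phi_scale.
exists (scale_set a I); first by exists a.
by rewrite Phi_scale.
Qed.

Lemma class_number_dvd M N n T beta : (1 < M %% 4)%N -> ~~ (3 %| M)%N -> odd n ->
  Qsqrt (- M%:Z) beta -> beta + beta^* = T%:R -> beta * beta^* = (N ^ n)%:R ->
  coprime T N -> (0 < T)%N -> (T + n.+1 * T ^ n < N)%N ->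
  forall h, has_class_number (Qsqrt (- M%:Z)) h -> (n %| h)%N.
Proof.
move=> M4 M3 n_odd Kb trb nmb cTN T0 Nbig h hK.
have M0 : (0 < M)%N by case: (M) M4.
have N0 : (0 < N)%N by case: (N) Nbig.
have nf := Qsqrt_rational_norm_form M0.
have sK := Qsqrt_subfield (- M%:Z).
have Ob := integers_beta Kb trb nmb.
set K := Qsqrt _ in Kb hK nf sK Ob.
have nzb : beta != 0.
  have : beta * beta^* != 0 by rewrite nmb pnatr_eq0 -lt0n expn_gt0 N0.
  by rewrite mulf_eq0 negb_or => /andP[].
pose phi (C : set (set algC)) := [set Phi N beta 1 J | J in C].
have iter_phi m I : fractional_ideal K I -> (m <= n)%N ->
    iter m phi (ideal_class K I) = ideal_class K (Phi N beta m I).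
  move=> fI mn; rewrite -(iter_Phi nf Ob trb nmb cTN N0 fI mn).
  by elim: m {mn} => //= m ->; rewrite /phi image_Phi_class.
apply: (dvdn_card_free_iter_set hK (f := phi)); first by case: (n) n_odd.
- move=> _ [I fI <-]; exists (Phi N beta 1 I); last by rewrite /phi image_Phi_class.
  exact: Phi_fractional.
- move=> _ [I fI <-]; rewrite iter_phi // (Phi_n nf Ob nmb fI).
  exact: ideal_class_scale.
move=> m _ [I fI <-] mn m0; rewrite iter_phi //; last by case/andP: m0 => _ /ltnW.
move=> /(ideal_class_eq sK)[g [Kg nzg PE]].
exact: (Phi_not_scale M4 M3 n_odd Kb trb nmb cTN T0 Nbig fI mn m0 Kg nzg PE).
Qed.

(** * Finiteness of the class group *)

(** Pigeonhole: the fractional parts of 0, b, ..., L b fall into [L] intervals of length 1/L, so two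
    of them share one. *)
Lemma dirichlet_approximation (R : archiRealFieldType) (b : R) (L : nat) : (0 < L)%N ->
  exists (k : nat) (q : int), (0 < k <= L)%N /\ `|k%:R * b - q%:~R| * L%:R <= 1.
Proof.
case: L => // L _.
pose fl (i : nat) := Num.floor (i%:R * b).
pose fr (i : nat) := L.+1%:R * (i%:R * b - (fl i)%:~R).
have fr0 i : 0 <= fr i by rewrite mulr_ge0 // subr_ge0 floor_le.
have fr1 i : fr i < L.+1%:R.
  rewrite -[ltRHS]mulr1 ltr_pM2l ?ltr0n // ltrBlDl.
  by have := floorD1_gt (i%:R * b); rewrite intrD addrC.
pose f (i : 'I_L.+2) : 'I_L.+1 := inord (Num.truncn (fr i)).
have fE i : nat_of_ord (f i) = Num.truncn (fr i).
  by rewrite /f inordK // truncn_lt_nat // fr1.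
have : ~~ injectiveb f.
  by apply/injectiveP => /leq_card; rewrite !card_ord ltnn.
move=> /injectivePn[i [j nij fij]].
wlog ltij : i j nij fij / (i < j)%N.
  move=> W; have [ij|ji|eij] := ltngtP i j; first exact: (W i j).
    by apply: (W j i) => //; rewrite eq_sym.
  by move: nij; rewrite (val_inj eij) eqxx.
exists (j - i)%N, (fl j - fl i); split; first by have := ltn_ord j; lia.
have -> : (j - i)%:R * b - (fl j - fl i)%:~R = (fr j - fr i) / L.+1%:R.
  by rewrite natrB ?(ltnW ltij) // intrB /fr; field; rewrite addrC natr1 pnatr_eq0.
rewrite normrM normfV [X in _ / X]gtr0_norm ?ltr0n // divfK ?pnatr_eq0 //.
have := congr1 (@nat_of_ord _) fij; rewrite !fE => tij.
have /andP[ti1 ti2] := truncn_itv (fr0 i); have /andP[tj1 tj2] := truncn_itv (fr0 j).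
rewrite ler_norml; rewrite -tij -natr1 in tj1 tj2; rewrite -natr1 in ti2.
by apply/andP; split; lra.
Qed.

Lemma nearest_int (R : archiRealFieldType) (a : R) : exists p : int, `|a - p%:~R| <= 2^-1.
Proof.
exists (Num.floor (a + 2^-1)).
have := floor_le (a + 2^-1); have := floorD1_gt (a + 2^-1); rewrite intrD.
by move: (Num.floor _)%:~R => p lt1 le1; rewrite ler_norml; apply/andP; split; lra.
Qed.

Section Finiteness.

Variable M : nat.
Hypothesis M_gt0 : (0 < M)%N.
Local Notation K := (Qsqrt (- M%:Z)).
Local Notation w := (sqrtC ((- M%:Z)%:~R : algC)).
Local Notation OK := (ring_of_integers K).
(** A common multiple of all denominators up to [M.+1] that Dirichlet approximation can return. *)
Local Notation E := (M.+1)`!%N.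

Let nf := Qsqrt_rational_norm_form M_gt0.

Lemma integers_w : OK w.
Proof.
split; first exact: Qsqrt_w.
apply: (@quadratic_root_Aint 0 M 1) => //.
by rewrite mul0r subr0 addn1 expr2 sqr_w addNr.
Qed.

(* The bounded denominator comes from Dirichlet approximation of the coefficient
   of w, since a nonzero element of J has absolute value at least 1. *)
Lemma reduced_lattice_denominator (J : set algC) x :
  (forall y z, J y -> J z -> J (y - z)) -> (forall (k : nat) y, J y -> J (k%:R * y)) ->
  (forall p q : int, J (p%:~R + q%:~R * w)) ->
  (forall y, J y -> y != 0 -> 1 <= `|y|) ->
  K x -> J x -> exists P Q : int, x = (P%:~R + Q%:~R * w) / E%:R.
Proof.
move=> JB JZ JO J1 /(QsqrtP M_gt0)[_ [_ [/CratP[a ->] /CratP[b ->] xE]]] Jx.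
have [k [q [/andP[k0 kL] qE]]] := dirichlet_approximation b (ltn0Sn M).
have [p pE] := nearest_int (k%:R * a).
set e := k%:R * a - p%:~R in pE; set d := k%:R * b - q%:~R in qE.
pose y := k%:R * x - (p%:~R + q%:~R * w).
have yE : y = ratr e + ratr d * w.
  by rewrite /y /e /d xE !rmorphB !rmorphM /= !ratr_int !ratr_nat; ring.
clearbody e d.
have y0 : y = 0.
  apply/eqP; apply: contraT => nzy; have := J1 y _ nzy.
  have -> : 1 <= `|y| = false.
    apply/negbTE; rewrite -real_ltNge ?normr_real ?real1 //.
    rewrite -(@expr_lt1 _ 2) // normCK.
    have -> : y * y^* = ratr (e * e + M%:R * (d * d)).
      have -> : y^* = ratr e - ratr d * w.
        by rewrite yE conj_Qsqrt // Crat_rat.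
      rewrite yE.
      rewrite rmorphD !rmorphM /= ratr_nat.
      have := sqr_w M; move: (sqrtC _) => v vv; ring: vv.
    rewrite -(rmorph1 (@ratr algC)) ltr_rat.
    have e2 : e * e <= 4^-1.
      have -> : e * e = `|e| * `|e| by rewrite -normrM ger0_norm // -expr2 sqr_ge0.
      by have := normr_ge0 e; nra.
    have d2 : M%:R * (d * d) <= 4^-1.
      have -> : d * d = `|d| * `|d| by rewrite -normrM ger0_norm // -expr2 sqr_ge0.
      have := normr_ge0 d; have : 0 <= M%:R :> rat by rewrite ler0n.
      move: qE; rewrite -natr1; move: `|d| (M%:R : rat) => D m mD m0 D0.
      (* [4 m D ^ 2] is the difference of the squares of [D * (m + 1)] and [D * (m - 1)], hence at
         most 1. *)
      have : (D * (m + 1)) * (D * (m + 1)) <= 1.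
        by rewrite mulr_ile1 // mulr_ge0 // addr_ge0.
      have := sqr_ge0 (D * (m - 1)); rewrite expr2; lra.
    by lra.
  apply=> //; apply: JB => //; exact: JZ.
have /dvdnP[c cE] : (k %| E)%N by apply: dvdn_fact; rewrite k0.
exists (p * c), (q * c).
have nzE : E%:R != 0 :> algC by rewrite pnatr_eq0 -lt0n fact_gt0.
apply: (mulIf nzE); rewrite divfK // !intrM cE natrM.
move/eqP: y0; rewrite subr_eq0 => /eqP kx.
have -> : x * (c%:R * k%:R) = c%:R * (k%:R * x) by ring.
by rewrite kx -[c%:Z%:~R]/(c%:R : algC); ring.
Qed.

(** A union of cosets of Z + Z w inside (Z + Z w)/E; the index [S] ranges over a finite type, which
    is the source of finiteness. *)
Definition lattice_of_residues (S : {set 'I_E * 'I_E}) : set algC :=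
  [set z | exists (p q : int) (ij : 'I_E * 'I_E), ij \in S /\
    z = p%:~R + q%:~R * w + (ij.1%:R + ij.2%:R * w) / E%:R].

(** Dividing [I] by a shortest vector gives [J] containing the ring of integers and having minimum
    1. By the bounded denominator, [J] is determined by the residues modulo [E] that it contains. *)
Lemma class_of_residues I : fractional_ideal K I ->
  exists S, ideal_class K I = ideal_class K (lattice_of_residues S).
Proof.
move=> fI; have sK := Qsqrt_subfield (- M%:Z).
have [c [Ic nzc cmin]] := ideal_minimal_element nf fI.
pose J := scale_set c^-1 I.
have Kc : K c by apply: (frac_sub fI).
have JD y z : J y -> J z -> J (y + z).
  by move=> [y' Iy <-] [z' Iz <-]; exists (y' + z'); [exact: (frac_add fI) | ring].
have JM y z : OK y -> J z -> J (y * z).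
  by move=> Oy [z' Iz <-]; exists (y * z'); [exact: (frac_mul fI) | ring].
have JB y z : J y -> J z -> J (y - z).
  move=> Jy Jz; apply: (JD) => //; rewrite -mulN1r; apply: (JM) => //.
  exact: (integers_int nf (-1)).
have JO y : OK y -> J y.
  by move=> Oy; rewrite -[y]mulr1; apply: (JM) => //; exists c => //; rewrite mulVf.
have Jpq (p q : int) : J (p%:~R + q%:~R * w).
  apply: JO; apply: (integersD nf); first exact: (integers_int nf).
  by apply: (integersM nf); [exact: (integers_int nf) | exact: integers_w].
have J1 y : J y -> y != 0 -> 1 <= `|y|.
  move=> [z Iz <-] nz; have nzz : z != 0 by apply: contraNneq nz => ->; rewrite mulr0.
  by rewrite normrM normfV ler_pdivlMl ?normr_gt0 // mulr1; apply: cmin.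
have JK y : J y -> K y.
  move=> [z Iz <-].
  by apply: (subfieldM sK); [exact: (subfieldV sK) | exact: (frac_sub fI)].
have JZ (k : nat) y : J y -> J (k%:R * y) by apply: (JM); exact: (integers_int nf k).
exists [set ij : 'I_E * 'I_E | `[< J ((ij.1%:R + ij.2%:R * w) / E%:R) >]]%SET.
have nzE : E%:R != 0 :> algC by rewrite pnatr_eq0 -lt0n fact_gt0.
have nzEz : E%:Z != 0 by rewrite eqz_nat -lt0n fact_gt0.
suff <- : J = lattice_of_residues [set ij : 'I_E * 'I_E |
    `[< J ((ij.1%:R + ij.2%:R * w) / E%:R) >]]%SET.
  by rewrite ideal_class_scale ?invr_eq0 //; exact: (subfieldV sK).
apply/seteqP; split=> [x Jx|z [p [q [ij [ijS ->]]]]]; last first.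
  by move: ijS; rewrite inE => /asboolP Jij; apply: JD.
have [P [Q xE]] := reduced_lattice_denominator JB JZ Jpq J1 (JK _ Jx) Jx.
have res (A : int) : exists i : 'I_E, A = (A %/ E)%Z * E + i.
  have lt : (`|(A %% E)%Z| < E)%N.
    by rewrite -ltz_nat gez0_abs ?modz_ge0 // ltz_pmod // ltz_nat fact_gt0.
  by exists (Ordinal lt); rewrite /= gez0_abs ?modz_ge0 // -divz_eq.
have [i Pi] := res P; have [j Qj] := res Q.
have xE' : x = (P %/ E)%Z%:~R + (Q %/ E)%Z%:~R * w + (i%:R + j%:R * w) / E%:R.
  rewrite xE {1}Pi {1}Qj !intrD !intrM -[E%:Z%:~R]/(E%:R : algC).
  rewrite -[i%:Z%:~R]/(i%:R : algC) -[j%:Z%:~R]/(j%:R : algC).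
  by apply: (mulIf nzE); rewrite divfK // [RHS]mulrDl divfK //; ring.
exists (P %/ E)%Z, (Q %/ E)%Z, (i, j); split=> //=.
rewrite inE; apply/asboolP => /=.
have -> : (i%:R + j%:R * w) / E%:R = x - ((P %/ E)%Z%:~R + (Q %/ E)%Z%:~R * w).
  by rewrite xE' [X in X - _]addrC addrK.
exact: JB.
Qed.

Lemma class_group_finite : finite_set (class_group K).
Proof.
apply: (@sub_finite_set _ _
  [set ideal_class K (lattice_of_residues S) | S in [set: {set 'I_E * 'I_E}]]).
  by move=> _ [I fI <-]; have [S ->] := class_of_residues fI; exists S.
exact/finite_image/finite_finset.
Qed.

End Finiteness.

(** The class of the ring of integers is always present. Positivity turns divisibility by a large
    number into a lower bound. *)
Lemma class_number_gt0 M h :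
  (0 < M)%N -> has_class_number (Qsqrt (- M%:Z)) h -> (0 < h)%N.
Proof.
move=> M0; have nf := Qsqrt_rational_norm_form M0.
case: h => // hK; exfalso.
set K := Qsqrt _ in nf hK.
have fO : fractional_ideal K (ring_of_integers K).
  split.
  - by move=> x [].
  - by exists 1; [exact: (integers_int nf 1) | rewrite oner_eq0].
  - exact: (integersD nf).
  - exact: (integersM nf).
  exists 1; first by split; [exact: (integers_int nf 1) | rewrite oner_eq0].
  by move=> x; rewrite mul1r.
have : class_group K (ideal_class K (ring_of_integers K)).
  by exists (ring_of_integers K).
move: hK; rewrite /has_class_number II0 => /card_set_bijP[f [fA _ _]] cl.
by have := fA _ cl.
Qed.

Lemma class_number_exists M N n T beta : (1 < M %% 4)%N -> ~~ (3 %| M)%N -> odd n ->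
  Qsqrt (- M%:Z) beta -> beta + beta^* = T%:R -> beta * beta^* = (N ^ n)%:R ->
  coprime T N -> (0 < T)%N -> (T + n.+1 * T ^ n < N)%N ->
  exists2 h, has_class_number (Qsqrt (- M%:Z)) h & (0 < h)%N /\ (n %| h)%N.
Proof.
move=> M4 M3 n_odd Kb trb nmb cTN T0 Nbig.
have M0 : (0 < M)%N by case: (M) M4.
have [h hK] := class_group_finite M0.
exists h => //; split; first exact: (class_number_gt0 M0 hK).
exact: (class_number_dvd M4 M3 n_odd Kb trb nmb cTN T0 Nbig hK).
Qed.

(** * The explicit family of fields *)

Lemma class_number_square_shift (y n x M : nat) : odd n -> (1 < M %% 4)%N ->
  ~~ (3 %| M)%N -> (y ^ n = M + x * x)%N -> (0 < x)%N -> coprime x.*2 y ->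
  (x.*2 + n.+1 * x.*2 ^ n < y)%N ->
  exists2 h, has_class_number (Qsqrt (- M%:Z)) h & (0 < h)%N /\ (n %| h)%N.
Proof.
move=> n_odd M4 M3 yE x0 cxy ybig.
have M0 : (0 < M)%N by case: (M) M4.
have Qx : x%:R \in Crat by rewrite rpred_nat.
apply: (@class_number_exists M y n x.*2 (x%:R + 1 * sqrtC ((- M%:Z)%:~R))) => //.
- by apply/(QsqrtP M0); exists x%:R, 1; rewrite Qx Crat1.
- by rewrite conj_Qsqrt ?Crat1 // -addnn natrD; ring.
- rewrite conj_Qsqrt ?Crat1 // yE natrD natrM.
  have := sqr_w M; move: (sqrtC _) => v vv; ring: vv.
- by rewrite double_gt0.
Qed.

Lemma class_number_odd_power (y z n : nat) : odd n -> (y.+1 = 4 * z ^ n)%N ->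
  (1 < (y ^ n) %% 4)%N -> ~~ (3 %| y ^ n)%N -> (1 + n.+1 < z)%N ->
  exists2 h, has_class_number (Qsqrt (- (y ^ n)%:Z)) h & (0 < h)%N /\ (n %| h)%N.
Proof.
move=> n_odd yE M4 M3 zbig.
have M0 : (0 < y ^ n)%N by case: (y ^ n)%N M4.
have y0 : (0 < y)%N by case: (y) M0 (n_odd) => //; rewrite exp0n //; case: (n) n_odd.
have nE : n = (n./2 + n./2).+1 by rewrite addnn -[LHS]odd_double_half n_odd.
have nzy : y%:R != 0 :> algC by rewrite pnatr_eq0 -lt0n.
(* The field is given by a root of [- y ^ n]; with [n] odd, dividing that root by [ys] yields a
   square root of [- y]. *)
set ys : algC := y%:R ^+ n./2.
have nzys : ys != 0 by rewrite expf_neq0.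
have Qa : 2^-1 \in Crat by rewrite rpredV rpred_nat.
have Qb : 2^-1 / ys \in Crat by rewrite rpred_div // rpredX // rpred_nat.
apply: (@class_number_exists _ z n 1
  (2^-1 + 2^-1 / ys * sqrtC ((- (y ^ n)%:Z)%:~R))) => //.
- by apply/(QsqrtP M0); exists 2^-1, (2^-1 / ys).
- by rewrite conj_Qsqrt //; field.
- rewrite conj_Qsqrt //.
  have := sqr_w (y ^ n); move: (sqrtC _) => v vv.
  have yys : (y ^ n)%:R = y%:R * (ys * ys) by rewrite nE expnS expnD natrM natrM !natrX.
  have z4 : (z ^ n)%:R = (y%:R + 1) / 4%:R :> algC.
    by rewrite natr1 yE natrM mulrC mulKf // pnatr_eq0.
  rewrite yys in vv.
  have -> : (2^-1 + 2^-1 / ys * v) * (2^-1 - 2^-1 / ys * v) =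
      4%:R^-1 - 4%:R^-1 * (v * v) / (ys * ys).
    by field.
  by rewrite vv z4; field.
- exact: coprime1n.
- by rewrite exp1n muln1.
Qed.

Lemma shifted_class_numbers (n : nat) : odd n -> exists d : int,
  forall k : int, k \in [:: 0; 1; 4; 36; 100] -> d + k < 0 /\
    exists2 h, has_class_number (Qsqrt (d + k)) h & (0 < h)%N /\ (n %| h)%N.
Proof.
move=> n_odd; have n0 : (0 < n)%N by case: n n_odd.
(* 20 is the largest trace [2 x], reached at [x = 10], so [c] dominates the size condition for all
   traces used. *)
pose c := (20 + n.+1 * 20 ^ n)%N.
(* The factor 60 makes [y + 1 = 4 z ^ n] divisible by 240. Hence [y] is -1 modulo 12 and coprime to
   the traces 2, 4, 12, 20, which divide 240. *)
pose z := (60 * c)%N.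
pose e := (c * z ^ n.-1)%N.
have zn : (z ^ n = 60 * e)%N by rewrite -{1}(prednK n0) expnS /z /e mulnA.
have c20 : (20 <= c)%N by rewrite leq_addr.
have e0 : (c <= e)%N by rewrite leq_pmulr // expn_gt0 muln_gt0; lia.
pose y := (240 * e).-1.
have yE : y.+1 = (4 * z ^ n)%N by rewrite zn /y; lia.
have zy : (z <= y)%N by rewrite /z /y; lia.
have y12 : (y %% 12 = 11)%N by rewrite /y; lia.
have yn12 : (y ^ n %% 12 = 11)%N.
  rewrite -[n]odd_double_half n_odd expnS -mul2n expnM -modnMm y12.
  by rewrite -[((y ^ 2) ^ _ %% 12)%N]modnXm -[(y ^ 2 %% 12)%N]modnXm y12 exp1n.
have yn : (y <= y ^ n)%N by rewrite -{1}(expn1 y) leq_pexp2l //; lia.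
have bound T : (0 < T <= 20)%N -> (T + n.+1 * T ^ n < z)%N.
  move=> /andP[T0 T20]; have : (T + n.+1 * T ^ n <= c)%N.
    by rewrite leq_add // leq_pmul2l // leq_exp2r.
  by rewrite /z; lia.
have cop T : (T %| 240)%N -> coprime T y.
  move=> T240; apply: (coprime_dvdl T240).
  have y1 : (240 * e = y.+1)%N by rewrite /y; lia.
  have: (gcdn 240 y %| y.+1 - y)%N.
    by rewrite dvdn_sub // ?dvdn_gcdr // -y1 dvdn_mulr // dvdn_gcdl.
  by rewrite subSnn dvdn1.
have shift (x : nat) : x \in [:: 1; 2; 6; 10]%N ->
  exists2 h, has_class_number (Qsqrt (- (y ^ n)%:Z + (x * x)%:Z)) h &
    (0 < h)%N /\ (n %| h)%N.
  move=> xs.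
  have xx : (0 < x <= 10)%N /\ (x.*2 %| 240)%N.
    by move: xs; rewrite !inE => /or4P[] /eqP ->.
  have le100 : (x * x <= y ^ n)%N.
    have : (x * x <= 10 * 10)%N by case: xx => /andP[_ x10] _; rewrite leq_mul.
    by move: yn zy; rewrite /z; move: (y ^ n)%N; lia.
  have -> : - (y ^ n)%:Z + (x * x)%:Z = - (y ^ n - x * x)%N%:Z.
    by rewrite -subzn // opprB addrC.
  (* Modulo 12, [y ^ n] is 11 and the squares of 1, 2, 6, 10 are 1, 4, 0, 4, so the difference is
     10, 7, 11 or 7. *)
  have [M4 M3] : (1 < (y ^ n - x * x) %% 4)%N /\ ~~ (3 %| y ^ n - x * x)%N.
    move: xs yn12 le100; rewrite !inE; move: (y ^ n)%N => Y.
    by case/or4P=> /eqP ->; lia.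
  apply: (@class_number_square_shift y n x) => //; [by rewrite subnK | by lia | |].
    by apply: cop; case: xx.
  by rewrite (leq_trans _ zy) // bound //; lia.
exists (- (y ^ n)%:Z) => k ks; split.
  by move: ks yn zy c20; rewrite !inE /z; move: (y ^ n)%N; lia.
have : k = 0 \/ k \in [:: 1; 4; 36; 100].
  by move: ks; rewrite inE => /orP[/eqP|]; [left | right].
case=> [->|].
  rewrite addr0; apply: (class_number_odd_power n_odd yE); try (by move: yn12; lia).
  by have := bound 1%N isT; rewrite exp1n muln1.
rewrite !inE => /or4P[] /eqP ->.
- exact: (shift 1%N).
- exact: (shift 2%N).
- exact: (shift 6%N).
- exact: (shift 10%N).
Qed.

(** * Infinitely many quintuples from unbounded class numbers *)

Theorem theorem1p2 (n : nat) (n_ge1 : (1 <= n)%N) (n_odd : odd n) :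
  infinite_set
    [set (Qsqrt d, Qsqrt (d + 1), Qsqrt (d + 4), Qsqrt (d + 36),
          Qsqrt (d + 100))
    | d in [set d : int | forall k : int, k \in [:: 0; 1; 4; 36; 100] ->
              d + k < 0 /\ class_number_divisible_by n (Qsqrt (d + k))]].
Proof.
move=> /finite_seqP[s sE].
(* Finitely many quintuples would bound the class numbers of their first fields. A field without a
   class number imposes no constraint; otherwise the class number is unique. *)
have [B hB] : exists B : nat, forall t, t \in s ->
    forall h, has_class_number t.1.1.1.1 h -> (h <= B)%N.
  elim: s {sE} => [|t s [B hB]]; first by exists 0%N.
  have [[b hb]|nob] := pselect (exists b, has_class_number t.1.1.1.1 b); last first.
    exists B => u; rewrite inE => /orP[/eqP -> h hh|us]; last exact: hB.
    by case: nob; exists h.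
  exists (b + B)%N => u; rewrite inE => /orP[/eqP -> h hh|us h hh].
    have := card_eq_trans (card_esym hb) hh => /card_eq_II <-; exact: leq_addr.
  by rewrite (leq_trans (hB u us h hh)) // leq_addl.
(* An odd multiple of [n] exceeding [B]: the first field of the resulting quintuple has a class
   number above the bound. *)
have odd_n' : odd (n * B.*2.+1) by rewrite oddM n_odd /= odd_double.
have [d dP] := shifted_class_numbers odd_n'.
have dvd_n : forall k : int, k \in [:: 0; 1; 4; 36; 100] ->
    d + k < 0 /\ class_number_divisible_by n (Qsqrt (d + k)).
  move=> k /dP[dk [h hK [_ nh]]]; split=> //; exists h => //.
  exact: dvdn_trans (dvdn_mulr _ _) nh.
have inS : (Qsqrt d, Qsqrt (d + 1), Qsqrt (d + 4), Qsqrt (d + 36), Qsqrt (d + 100)) \in s.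
  have : [set` s] (Qsqrt d, Qsqrt (d + 1), Qsqrt (d + 4), Qsqrt (d + 36), Qsqrt (d + 100)).
    by rewrite -sE; exists d.
  by [].
have [_ [h]] := dP 0 isT; rewrite addr0 => hK [h0 /(dvdn_leq h0) nh].
have := hB _ inS h hK; move: nh; have := leq_pmull B.*2.+1 n_ge1; lia.
Qed.
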